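(* Let $b(n)$ be the number of non-Rascoe partitions of $n$ (with $b(0)=1$), and let $\sigma_2(q)=\sum_{n=0}^{\infty}\frac{(-1)^nq^{n^2}}{(-q;q)_n}$. Then for $|q|<1$, \[ \sum_{n=0}^{\infty}b(n)q^n=(-q;q)_{\infty}\,\sigma_2(q)=\sum_{n=0}^{\infty}(-1)^nq^{n^2}(-q^{n+1};q)_{\infty}. \]
   Context: A non-Rascoe partition of a positive integer $n$ is a partition of $n$ into distinct parts in which the number of parts is not itself a part; the empty partition is counted as the unique non-Rascoe partition of $0$, so $b(0)=1$. Notation: $(a;q)_0=1$, $(a;q)_n=\prod_{k=0}^{n-1}(1-aq^k)$, $(a;q)_\infty=\prod_{k=0}^{\infty}(1-aq^k)$ for $|q|<1$. *)

(* Defs.v *)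
From HB Require Import structures.
From mathcomp Require Import all_boot all_order all_algebra.
From mathcomp Require Import all_classical all_reals all_analysis.
From mathcomp Require Export complex.

Set Implicit Arguments.
Unset Strict Implicit.
Unset Printing Implicit Defensive.

Import Order.TTheory GRing.Theory Num.Theory.
Import numFieldNormedType.Exports.

(* A partition of n into distinct parts is the set of its parts, a set of
   positive integers (all at most n) with sum n. The bounds lose nothing, and
   the number of parts is the cardinality of the set. *)
Definition distinct_partition (n : nat) (A : {set 'I_n.+1}) : bool :=
  (ord0 \notin A) && (\sum_(i in A) i == n).

Definition non_Rascoe (n : nat) (A : {set 'I_n.+1}) : bool :=
  distinct_partition A && ~~ [exists i in A, (i == #|A| :> nat)].

Definition b (n : nat) : nat := #|[set A : {set 'I_n.+1} | non_Rascoe A]%SET|.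

Lemma b0 : b 0 = 1%N.
Proof.
rewrite /b; apply/eqP/cards1P; exists finset.set0; apply/setP => A.
rewrite !inE /non_Rascoe /distinct_partition.
apply/idP/eqP => [/andP[/andP[A0 _] _]|->].
  by apply/setP => i; rewrite inE (ord1 i); apply: negbTE.
by rewrite inE big_set0 eqxx /=; apply/existsPn => i; rewrite inE.
Qed.

Local Open Scope classical_set_scope.
Local Open Scope ring_scope.

Section qseries.
Variable C : numFieldType.
Implicit Types a q : C.

(* (a; q)_n and (a; q)_oo *)
Definition qpoch a q (n : nat) : C := \prod_(0 <= k < n) (1 - a * q ^+ k).

Definition qpoch_inf a q : C := limn (qpoch a q).

Definition sigma2_term q (n : nat) : C :=
  (-1) ^+ n * q ^+ (n ^ 2) / qpoch (- q) q n.

Definition sigma2 q : C := limn (series (sigma2_term q)).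

End qseries.

(* Main.v *)
(* Consider the pairs (n, B) with B a finite set of integers > n, weighted by
   n^2 + (sum of B); their generating function for fixed n is
   q^(n^2) (-q^(n+1); q)_oo. If p = |B| + 2n is an element of B, remove it from
   B and add 1 to every other element: this gives a pair (n+1, B') of the same
   weight with |B'| + 2(n+1) not in B', and every such pair arises exactly once.
   Hence the alternating sum over n telescopes to the pairs (0, B) with |B| not
   in B, which are the non-Rascoe partitions.

   When all parts are at most M, this holds exactly in weights < M, and the
   product side is (-q; q)_M times a partial sum of sigma_2. The remaining
   weights contribute O((r/s)^M) where r = |q| < s < 1: r^w <= (r/s)^M s^w for
   w >= M, and the sum of all the s^w is bounded uniformly in M. *)
Require Import Defs.
From mathcomp Require Import all_boot all_order all_algebra.
From mathcomp Require Import all_classical all_reals all_analysis.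
From mathcomp Require Import zify ring lra.
Import Order.TTheory GRing.Theory Num.Theory numFieldNormedType.Exports.

(** * The weight-preserving bijection on sets of parts bounded by M *)

Section Pairs.
Set Implicit Arguments.
Unset Strict Implicit.
Variable M : nat.
Implicit Types (n : nat) (A : {set 'I_M.+1}).

Definition weight n A : nat := n ^ 2 + \sum_(i in A) i.

Definition parts_above n A : bool := [forall i in A, n < i].

Definition hits n A : bool := [exists i in A, i == #|A| + n.*2 :> nat].

(** At [i = M] the successor leaves the ordinal type and [inord] falls back to 0; weights below M
    exclude this. *)
Definition raise n A : {set 'I_M.+1} :=
  [set inord i.+1 | i : 'I_M.+1 in [set i in A | i != #|A| + n.*2 :> nat]].

(** The reinserted part is |A| + 1 + 2n because the enlarged set has |A| + 1 elements. *)
Definition lower n A : {set 'I_M.+1} :=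
  inord (#|A| + n.*2).+1 |: [set inord i.-1 | i : 'I_M.+1 in A].

Lemma leq_part_sum A (i : 'I_M.+1) : i \in A -> i <= \sum_(j in A) j.
Proof. by move=> iA; rewrite (bigD1 i) //= leq_addr. Qed.

Lemma leq_card_sum n A : parts_above n A -> #|A| * n.+1 <= \sum_(j in A) j.
Proof.
by move=> /forall_inP nA; rewrite -sum_nat_const; apply: leq_sum.
Qed.

Lemma lower_part n A (i : 'I_M.+1) : parts_above n A -> i \in A ->
  (inord i.-1 : 'I_M.+1) = i.-1 :> nat /\ i.-1.+1 = i :> nat.
Proof.
move=> /forall_inP nA iA; have := nA i iA; have := ltn_ord i => *.
by rewrite inordK; lia.
Qed.

Lemma raise_part n A (i : 'I_M.+1) : weight n A < M -> i \in A ->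
  (inord i.+1 : 'I_M.+1) = i.+1 :> nat.
Proof.
rewrite /weight => wA iA; have := leq_part_sum iA => *.
by rewrite inordK //; lia.
Qed.

Lemma raise_inj n A : weight n A < M ->
  {in A &, injective (fun i : 'I_M.+1 => inord i.+1 : 'I_M.+1)}.
Proof.
move=> wA i j iA jA /(congr1 (@nat_of_ord _)).
by rewrite (raise_part wA iA) (raise_part wA jA) => -[] /val_inj.
Qed.

Lemma lower_inj n A : parts_above n A ->
  {in A &, injective (fun i : 'I_M.+1 => inord i.-1 : 'I_M.+1)}.
Proof.
move=> nA i j iA jA /(congr1 (@nat_of_ord _)).
have [-> ei] := lower_part nA iA; have [-> ej] := lower_part nA jA.
by move=> e; apply/val_inj; rewrite /= -ei -ej e.
Qed.

(** Let p = |A| + 2n be the removed part. The increments of the other parts add |A| - 1 and the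
    square grows by 2n + 1, which together make up for p. For the new pair the forbidden value is
    (|A| - 1) + 2(n + 1) = p + 1, which only the removed p could have produced. *)
Lemma raiseP n A : parts_above n A -> weight n A < M -> hits n A ->
  [/\ parts_above n.+1 (raise n A), ~~ hits n.+1 (raise n A),
      weight n.+1 (raise n A) = weight n A & lower n (raise n A) = A].
Proof.
move=> nA wA /exists_inP[p pA /eqP pE].
have inj : {in A :\ p &, injective (fun i : 'I_M.+1 => inord i.+1 : 'I_M.+1)}.
  by apply: sub_in2 (raise_inj wA) => i /setD1P[].
have rE : raise n A = [set inord i.+1 | i : 'I_M.+1 in A :\ p].
  rewrite /raise (_ : [set i in A | _] = A :\ p) //; apply/setP => i.
  by rewrite !inE andbC -pE (inj_eq val_inj).
have cA : #|A| = #|A :\ p|.+1 by rewrite (cardsD1 p) pA.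
have cr : #|raise n A| = #|A|.-1 by rewrite rE card_in_imset // cA.
split.
- apply/forall_inP => j; rewrite rE => /imsetP[i /setD1P[_ iA] ->].
  by rewrite (raise_part wA iA) ltnS (forall_inP nA).
- apply/existsPn => j; apply/negP => /andP[]; rewrite rE.
  move=> /imsetP[i /setD1P[ip iA] ->]; rewrite (raise_part wA iA) -rE cr.
  move=> /eqP e; case/eqP: ip; apply/val_inj; rewrite /= pE.
  by move: e; rewrite cA; lia.
- rewrite /weight rE big_imset //= (eq_bigr (fun i : 'I_M.+1 => i + 1)).
    rewrite big_split /= sum1_card [in RHS](bigD1 p) //= pE cA.
    under [X in _ = _ + (_ + X)]eq_bigl do rewrite andbC -in_setD1.
    rewrite -!mulnn mulSn mulnS.
    set s := \sum_(i in A :\ p) i; set k := #|A :\ p|.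
    by move: s k; clear; lia.
  by move=> i /setD1P[_ iA]; rewrite (raise_part wA iA) addn1.
- rewrite /lower cr cA /= -addSn -cA -pE inord_val rE.
  rewrite -imset_comp (eq_in_imset (g := id)) ?imset_id ?finset.setD1K //.
  move=> i /setD1P[_ iA] /=; rewrite (raise_part wA iA) /=.
  by rewrite inord_val.
Qed.

(** The inserted part |A| + 2n + 1 is new exactly because |A| + 2(n + 1) is not in A, so the
    cardinality grows by one and [raise] removes this very part again. *)
Lemma lowerP n A : parts_above n.+1 A -> weight n.+1 A < M ->
    ~~ hits n.+1 A ->
  [/\ parts_above n (lower n A), hits n (lower n A),
      weight n (lower n A) = weight n.+1 A & raise n (lower n A) = A].
Proof.
move=> nA wA nh.
have pE : (inord (#|A| + n.*2).+1 : 'I_M.+1) = (#|A| + n.*2).+1 :> nat.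
  (* The new part fits: |A| + 2n + 1 <= (n + 1)^2 + |A|(n + 2) <= weight < M. *)
  rewrite inordK //; have := leq_card_sum nA; move: wA.
  by rewrite /weight -mulnn; nia.
have pN : inord (#|A| + n.*2).+1 \notin
    ([set inord i.-1 | i : 'I_M.+1 in A] : {set 'I_M.+1}).
  apply/imsetP => -[i iA /(congr1 (@nat_of_ord _))]; rewrite pE.
  have [-> ei] := lower_part nA iA => e.
  case/exists_inP: nh; exists i => //; apply/eqP; lia.
have inj := lower_inj nA.
have cl : #|lower n A| = #|A|.+1 by rewrite cardsU1 pN card_in_imset.
have nl : parts_above n (lower n A).
  apply/forall_inP => j /setU1P[->|]; first by rewrite pE; lia.
  move=> /imsetP[i iA ->]; have [-> ei] := lower_part nA iA.
  by have := forall_inP nA i iA; lia.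
split=> //.
- apply/exists_inP; exists (inord (#|A| + n.*2).+1); first exact: setU11.
  by rewrite pE cl.
- rewrite /weight /lower big_setU1 //= pE big_imset //=.
  have -> : \sum_(i in A) i = \sum_(i in A) (inord i.-1 : 'I_M.+1) + #|A|.
    rewrite -sum1_card -big_split /=; apply: eq_bigr => i iA.
    by have [-> ei] := lower_part nA iA; rewrite addn1.
  rewrite -!mulnn mulSn mulnS; set s := \sum_(i in A) _.
  by move: s #|A|; clear; lia.
- have -> : raise n (lower n A) =
      [set inord i.+1 | i : 'I_M.+1 in
        [set inord i.-1 | i : 'I_M.+1 in A] : {set 'I_M.+1}].
    rewrite /raise cl addSn (_ : [set i in lower n A | _] =
      [set inord i.-1 | i : 'I_M.+1 in A]) //.
    apply/setP => i; apply/setIdP/idP => [[/setU1P[->|//]]|iS].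
      by rewrite pE eqxx.
    split; first by rewrite /lower setU1r.
    apply: contraNneq pN => e; rewrite (_ : inord _ = i) //.
    by apply/val_inj; rewrite /= pE e.
  rewrite -imset_comp (eq_in_imset (g := id)) ?imset_id //.
  move=> i iA /=; have [-> ->] := lower_part nA iA; exact: inord_val.
Qed.

End Pairs.

(** * Telescoping of the truncated generating functions *)

Section Count.
Set Implicit Arguments.
Unset Strict Implicit.

(** No part exceeds the sum N, so widening the range of parts adds no partitions. A single M can
    then serve all N < M. *)
Lemma b_bounded_parts N M : N < M -> b N = #|[set A : {set 'I_M.+1} |
  [&& parts_above 0 A, \sum_(i in A) i == N & ~~ hits 0 A]]%SET|.
Proof.
move=> NM; have NM1 : N.+1 <= M.+1 by rewrite ltnS ltnW.
pose f (A : {set 'I_N.+1}) := (widen_ord NM1 @: A)%SET.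
have winj : injective (widen_ord NM1).
  by move=> i j /(congr1 (@nat_of_ord _)) /= e; apply/val_inj.
have finj : injective f by apply: imset_inj.
have fsum A : \sum_(i in f A) i = \sum_(i in A) i.
  by rewrite big_imset //=; apply: in2W.
have fP A : [&& parts_above 0 (f A), \sum_(i in f A) i == N & ~~ hits 0 (f A)]
    = non_Rascoe A.
  rewrite /non_Rascoe /distinct_partition fsum -andbA; congr [&& _, _ & ~~ _].
    apply/forall_inP/idP => [A0|A0 j /imsetP[i iA ->] /=].
      apply: contraTN isT => oA.
      by have /= := A0 _ (imset_f (widen_ord NM1) oA).
    rewrite lt0n; apply: contraNneq A0 => i0.
    by rewrite (_ : ord0 = i) //; apply/val_inj.
  rewrite /hits card_imset // addn0.
  apply/exists_inP/exists_inP => -[].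
    by move=> j /imsetP[i iA ->] e; exists i.
  by move=> i iA e; exists (widen_ord NM1 i) => //; apply: imset_f.
rewrite /b -(card_imset _ finj); congr #|pred_of_set _|.
apply/setP => B; rewrite inE; apply/imsetP/idP => [[A]|BP].
  by rewrite inE => AP ->; rewrite fP.
have [_ /eqP sB _] := and3P BP.
exists [set i | widen_ord NM1 i \in B]%SET; last first.
  apply/setP => i; apply/idP/imsetP => [iB|[j]]; last by rewrite inE => ? ->.
  have iN : i < N.+1 by rewrite ltnS -sB leq_part_sum.
  have ei : i = widen_ord NM1 (Ordinal iN) by apply/val_inj.
  by exists (Ordinal iN); rewrite // inE -ei.
rewrite inE -fP (_ : f _ = B) //.
apply/setP => i; apply/imsetP/idP => [[j]|iB]; first by rewrite inE => ? ->.
have iN : i < N.+1 by rewrite ltnS -sB leq_part_sum.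
have ei : i = widen_ord NM1 (Ordinal iN) by apply/val_inj.
by exists (Ordinal iN); rewrite // inE -ei.
Qed.

Local Open Scope ring_scope.

Variables (A : comNzRingType) (q : A) (M : nat).

(** The ring is arbitrary because the sum is evaluated at the complex [q] and also at real
    majorants. *)
Definition weight_sum n (P : pred {set 'I_M.+1}) : A :=
  \sum_(B : {set 'I_M.+1} | P B) q ^+ weight n B.

Let small n (B : {set 'I_M.+1}) := parts_above n B && (weight n B < M)%N.

Lemma weight_sum_hits n :
  weight_sum n (fun B => small n B && hits n B) =
  weight_sum n.+1 (fun B => small n.+1 B && ~~ hits n.+1 B).
Proof.
rewrite /weight_sum (reindex_onto (lower n) (raise n)); last first.
  by move=> B /andP[/andP[nB wB] hB]; have [] := raiseP nB wB hB.
apply: eq_big => [B|B /andP[/andP[/andP[nB wB] hB] /eqP e]]; last first.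
  by have [_ _ <- _] := raiseP nB wB hB; rewrite e.
apply/idP/idP => [/andP[/andP[/andP[nB wB] hB] /eqP e]|].
  have [] := raiseP nB wB hB.
  by rewrite e /small => -> -> -> _; rewrite wB.
move=> /andP[/andP[nB wB] hB]; have [] := lowerP nB wB hB.
by rewrite /small => -> -> -> ->; rewrite wB eqxx.
Qed.

Lemma alternating_weight_sum :
  \sum_(0 <= n < M) (-1) ^+ n * weight_sum n (small n) =
  \sum_(0 <= N < M) (b N)%:R * q ^+ N.
Proof.
pose O n := weight_sum n (fun B => small n B && ~~ hits n B).
have step n : weight_sum n (small n) = O n.+1 + O n.
  by rewrite /O -weight_sum_hits /weight_sum (bigID (@hits M n)).
have telescope K : \sum_(0 <= n < K) (-1) ^+ n * weight_sum n (small n) =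
    O 0%N - (-1) ^+ K * O K.
  elim: K => [|K IH]; first by rewrite big_geq // expr0; ring.
  by rewrite big_nat_recr //= IH step exprS; ring.
rewrite telescope.
(* For n = M every weight is at least M^2 >= M, so the sum is empty. *)
have -> : O M = 0; last rewrite mulr0 subr0.
  apply: big1 => B /andP[/andP[_ wB] _]; move: wB; rewrite /weight -mulnn; nia.
rewrite /O /weight_sum big_mkord.
(* Group the sets by their sum; the index M of ['I_M.+1] is filtered out. *)
rewrite (partition_big (fun B : {set 'I_M.+1} =>
   inord (\sum_(i in B) i) : 'I_M.+1) (fun N => (N < M)%N)) /=; last first.
  by move=> B /andP[/andP[_ wB] _]; rewrite inordK // ltnS ltnW.
rewrite big_mkcond big_ord_recr /= ltnn addr0; apply: eq_bigr => N _.
rewrite ltn_ord.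
rewrite (eq_bigl (fun B => B \in [set A : {set 'I_M.+1} |
  [&& parts_above 0 A, \sum_(i in A) i == N & ~~ hits 0 A]%N]%SET)); last first.
  move=> B; rewrite inE /small /weight exp0n // add0n; apply/idP/idP.
    move=> /andP[/andP[/andP[-> sB] ->] /eqP/(congr1 (@nat_of_ord _)) /=].
    by rewrite inordK ?ltnS ?(ltnW sB) // => ->; rewrite eqxx.
  move=> /and3P[-> /eqP sB ->]; rewrite sB ltn_ord /=.
  by apply/eqP/val_inj; rewrite /= inordK // ltnS ltnW.
rewrite (eq_bigr (fun=> q ^+ N)) => [|B].
  by rewrite sumr_const -b_bounded_parts // mulr_natl.
by rewrite inE /weight => /and3P[_ /eqP -> _].
Qed.

End Count.

Local Open Scope classical_set_scope.
Local Open Scope ring_scope.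
Local Open Scope complex_scope.

(** * Convergence in R[i] from real bounds *)

Section Complex.
Set Implicit Arguments.
Unset Strict Implicit.
Variable R : realType.
Implicit Types (u : nat -> R[i]^o) (x : nat -> R).

Lemma normc_le_ReIm (z : R[i]) :
  `|z| <= (`|complex.Re z| + `|complex.Im z|)%:C.
Proof.
rewrite {1}[z]complexE (le_trans (ler_normD _ _)) //.
rewrite rmorphD /= normrM !normc_def /= !expr0n expr1n /= !addr0 add0r sqrtr1.
by rewrite !sqrtr_sqr mul1r.
Qed.

Lemma normcE (z : R[i]) : `|z| = (complex.Re `|z|)%:C.
Proof. by rewrite normc_def. Qed.

Lemma Re_norm_ge0 (z : R[i]) : 0 <= complex.Re `|z|.
Proof. by rewrite -lecR -normcE; exact: normr_ge0. Qed.

Lemma cvgc_to u (l : R[i]^o) x : (forall n, `|l - u n| <= (x n)%:C) ->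
  x @ \oo --> (0 : R) -> u @ \oo --> l.
Proof.
move=> ux /cvgrPdist_lt x0; apply/cvgrPdist_lt => e e0.
(* A positive element of R[i] is real, so the tolerance can be moved to R. *)
have eE : e = (complex.Re e)%:C by rewrite RRe_real // ger0_real // ltW.
have : 0 < complex.Re e by rewrite -ltcR -eE.
move=> /x0; apply: filterS => n /=.
rewrite sub0r normrN => xe; rewrite eE (le_lt_trans (ux n)) // ltcR.
exact: le_lt_trans (ler_norm _) xe.
Qed.

Lemma is_cvgc u : cvgn (fun n => complex.Re (u n)) ->
  cvgn (fun n => complex.Im (u n)) -> cvgn u.
Proof.
move=> /cvg_ex[a /= ua] /cvg_ex[c /= uc].
apply: (@cvgP _ _ (a +i* c : R[i]^o)).
apply: (@cvgc_to _ _
  (fun n => `|a - complex.Re (u n)| + `|c - complex.Im (u n)|)).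
  by move=> n; apply: le_trans (normc_le_ReIm _) _; case: (u n).
rewrite -[X in _ --> X](addr0 0).
apply: cvgD; apply/norm_cvg0P.
  rewrite -[X in _ --> X](subrr a); exact: cvgB (cvg_cst _) ua.
rewrite -[X in _ --> X](subrr c); exact: cvgB (cvg_cst _) uc.
Qed.

Lemma is_cvgc_series u (c r : R) : 0 <= r < 1 ->
  (forall n, `|u n| <= (c * r ^+ n)%:C) -> cvgn (series u).
Proof.
move=> /andP[r0 r1] ur.
(* One comparison with the geometric series covers both [Re] and [Im]. *)
have key (f : {additive R[i] -> R}) : (forall z, `|f z|%:C <= `|z|) ->
    cvgn (fun n => f (series u n)).
  move=> fz.
  have fu n : `|f (u n)| <= c * r ^+ n.
    by rewrite -lecR; have h := fz (u n); exact: le_trans h (ur n).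
  rewrite (_ : (fun n => _) = series (f \o u)); last first.
    by apply/funext => n; rewrite /series /= raddf_sum.
  apply: normed_cvg; apply: (@series_le_cvg _ _ (geometric c r)) => //.
  - by move=> n /=; apply: normr_ge0.
  - by move=> n /=; apply: le_trans (normr_ge0 (f (u n))) (fu n).
  - by apply: is_cvg_geometric_series; rewrite ger0_norm.
apply: is_cvgc.
  have h := key (@complex.Re R) (@normc_ge_Re R); exact: h.
have h := key (@complex.Im R); apply: h => z.
rewrite normc_def lecR -sqrtr_sqr; apply: ler_wsqrtr.
by rewrite lerDr sqr_ge0.
Qed.

End Complex.

(** * Uniform bounds for geometric sums and products *)

Section Bounds.
Set Implicit Arguments.
Unset Strict Implicit.
Variable R : realType.

Lemma sum_expr_le (r : R) n : 0 <= r < 1 ->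
  \sum_(0 <= k < n) r ^+ k <= (1 - r)^-1.
Proof.
move=> /andP[r0 r1].
have r' : 0 < 1 - r by rewrite subr_gt0.
rewrite -[leRHS]mul1r ler_pdivlMr // big_mkord mulrC -opprB mulNr -subrX1 opprB.
by rewrite lerBlDr lerDl exprn_ge0.
Qed.

(** By 1 + x <= e^x the product is at most the exponential of a geometric sum. *)
Lemma prod_geometric_le (c r : R) n : 0 <= c -> 0 <= r < 1 ->
  \prod_(0 <= k < n) (1 + c * r ^+ k) <= expR (c / (1 - r)).
Proof.
move=> c0 r01; have [r0 r1] := andP r01.
apply: (@le_trans _ _ (\prod_(0 <= k < n) expR (c * r ^+ k))).
  apply: ler_prod => k _; rewrite expR_ge1Dx andbT.
  by rewrite addr_ge0 // mulr_ge0 // exprn_ge0.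
rewrite -expR_sum ler_expR -mulr_sumr ler_wpM2l //.
exact: sum_expr_le.
Qed.

End Bounds.

(** * Finite q-products as generating functions *)

Section Products.
Set Implicit Arguments.
Unset Strict Implicit.

Lemma weight_sum_above (A : comNzRingType) (q : A) M n :
  weight_sum q n (@parts_above M n) =
  q ^+ (n ^ 2) * \prod_(n <= k < M) (1 + q ^+ k.+1).
Proof.
(* Padding with factors 0 + 1 for i <= n lets the product expand over all subsets, those with a part
   <= n contributing 0. *)
have -> : \prod_(n <= k < M) (1 + q ^+ k.+1) =
    \prod_(i < M.+1) ((if (n < i)%N then q ^+ i else 0) + 1).
  rewrite -(big_add1 _ _ n M.+1 xpredT (fun k => 1 + q ^+ k)) big_geq_mkord.
  rewrite big_mkcond; apply: eq_bigr => i _.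
  by rewrite addrC; case: ltnP => _; rewrite ?add0r ?addr0.
rewrite bigA_distr mulr_sumr /weight_sum big_mkcond; apply: eq_bigr => B _.
rewrite -big_mkcond /=.
case: ifPn => [/forall_inP nB|/forall_inPn[i iB /negbTE nB]].
  rewrite /weight exprD; congr (_ * _).
  by rewrite -prodrXr; apply: eq_bigr => i /nB ->.
by rewrite (bigD1 i) //= nB mul0r mulr0.
Qed.

Variable C : numFieldType.
Implicit Types a q : C.

Lemma qpochS a q n : qpoch a q n.+1 = qpoch a q n * (1 - a * q ^+ n).
Proof. by rewrite /qpoch big_nat_recr. Qed.

Lemma qpochD a q m n :
  qpoch a q (m + n) = qpoch a q m * qpoch (a * q ^+ m) q n.
Proof.
rewrite /qpoch (@big_cat_nat _ _ _ m) ?leq_addr //=; congr (_ * _).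
rewrite -{1}[m]add0n big_addn addKn; apply: eq_bigr => k _.
by rewrite -mulrA -exprD addnC.
Qed.

Lemma qpochN_neq0 q n : `|q| < 1 -> qpoch (- q) q n != 0.
Proof.
move=> q1; rewrite /qpoch prodf_seq_neq0; apply/allP => k _ /=.
rewrite mulNr opprK -exprS.
apply/eqP => /eqP; rewrite addr_eq0 => /eqP /(congr1 Num.norm).
rewrite normr1 normrN normrX => /eqP; apply/negP.
by rewrite eq_sym lt_eqF // exprn_ilt1.
Qed.

(** Each denominator of sigma_2 cancels the first n factors of (-q; q)_M; [weight_sum_above] expands
    the rest. *)
Lemma qpochN_sigma2 q M : `|q| < 1 ->
  qpoch (- q) q M * series (sigma2_term q) M =
  \sum_(0 <= n < M) (-1) ^+ n * weight_sum q n (@parts_above M n).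
Proof.
move=> q1; rewrite /series /= mulr_sumr; apply: eq_big_nat => n /andP[_ nM].
rewrite weight_sum_above /sigma2_term.
have -> : qpoch (- q) q M =
    qpoch (- q) q n * \prod_(n <= k < M) (1 + q ^+ k.+1).
  rewrite /qpoch (@big_cat_nat _ _ _ n) ?(ltnW nM) //=; congr (_ * _).
  by apply: eq_bigr => k _; rewrite mulNr opprK exprS.
by field; exact: qpochN_neq0.
Qed.

End Products.

(** * The contribution of weights at least M *)

Section Estimates.
Set Implicit Arguments.
Unset Strict Implicit.
Variable R : realType.

Lemma weight_sum_tail (r s : R) M : 0 <= r < s -> s < 1 ->
  \sum_(0 <= n < M) weight_sum r n
     (fun B : {set 'I_M.+1} => parts_above n B && (M <= weight n B)%N) <=
  expR (s / (1 - s)) / (1 - s) * (r / s) ^+ M.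
Proof.
move=> /andP[r0 rs] s1; have s0 : 0 < s by apply: le_lt_trans rs.
have s01 : 0 <= s < 1 by rewrite ltW.
have rs0 : 0 <= r / s by rewrite divr_ge0 // ltW.
have rs1 : r / s <= 1 by rewrite ler_pdivrMr // mul1r ltW.
(* The exponential bounds the product of the 1 + s^(k+1), and s^(n^2) <= s^n leaves a geometric sum
   in n, whence the factor 1 / (1 - s). *)
apply: (@le_trans _ _
  (\sum_(0 <= n < M) expR (s / (1 - s)) * (r / s) ^+ M * s ^+ n));
  last first.
  rewrite -mulr_sumr [leRHS]mulrAC ler_wpM2l ?mulr_ge0 ?expR_ge0 ?exprn_ge0 //.
  exact: sum_expr_le.
apply: ler_sum => n _.
apply: (@le_trans _ _ ((r / s) ^+ M * weight_sum s n (@parts_above M n))).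
  rewrite /weight_sum mulr_sumr big_mkcond [leRHS]big_mkcond /=.
  apply: ler_sum => B _; case: (parts_above n B) => //=.
  case: ifP => [Mw|_]; last by rewrite mulr_ge0 // exprn_ge0 // ltW.
  have -> : r ^+ weight n B = (r / s) ^+ weight n B * s ^+ weight n B.
    by rewrite -exprMn divfK // gt_eqF.
  by rewrite ler_wpM2r ?(exprn_ge0 _ (ltW s0)) // ler_wiXn2l.
rewrite [leRHS]mulrAC mulrC ler_wpM2r ?exprn_ge0 // weight_sum_above mulrC.
apply: ler_pM.
- by apply: prodr_ge0 => k _; rewrite addr_ge0 // exprn_ge0 // ltW.
- by rewrite exprn_ge0 // ltW.
- apply: (le_trans _ (prod_geometric_le M (ltW s0) s01)).
  (* For n > M the product is empty; otherwise it is completed by factors that are at least 1. *)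
  have [nM|Mn] := leqP n M; last first.
    rewrite big_geq ?(ltnW Mn) //; elim/big_ind : _ => // [x y|k _].
      exact: mulr_ege1.
    by rewrite lerDl mulr_ge0 ?exprn_ge0 // ltW.
  rewrite [leRHS](@big_cat_nat _ _ _ n) //=.
  under [X in _ <= _ * X]eq_bigr do rewrite -exprS.
  apply: ler_peMl.
    by apply: prodr_ge0 => k _; rewrite addr_ge0 // exprn_ge0 // ltW.
  elim/big_ind : _ => // [x y|k _]; first exact: mulr_ege1.
  by rewrite lerDl mulr_ge0 ?exprn_ge0 // ltW.
- rewrite ler_wiXn2l ?(ltW s0) ?(ltW s1) // -mulnn.
  by case: n => // n; rewrite leq_pmulr.
Qed.

End Estimates.

(** * Passage to the limit *)

Section Limits.
Set Implicit Arguments.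
Unset Strict Implicit.
Variable R : realType.
Variables (q : R[i]) (r : R).
Hypotheses (qE : `|q| = r%:C) (r01 : 0 <= r < 1).

Let r0 : 0 <= r. Proof. by have /andP[] := r01. Qed.
Let r1 : r < 1. Proof. by have /andP[] := r01. Qed.

Let q1 : `|q| < 1.
Proof. by rewrite qE -(rmorph1 (@real_complex R)) ltcR. Qed.

Let normX n : `|q ^+ n| = (r ^+ n)%:C.
Proof. by rewrite normrX qE rmorphXn. Qed.

Lemma norm_qpoch_le (a : R[i]) n :
  `|qpoch a q n| <= (expR (complex.Re `|a| / (1 - r)))%:C.
Proof.
have aE := normcE a.
have a0 := Re_norm_ge0 a.
apply: (@le_trans _ _ (\prod_(0 <= k < n) (1 + complex.Re `|a| * r ^+ k))%:C).
  rewrite normr_prod rmorph_prod; apply: ler_prod => k _.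
  rewrite normr_ge0 /= (le_trans (ler_normB _ _)) // normr1 normrM normX.
  by rewrite rmorphD rmorph1 rmorphM /= -aE.
by rewrite lecR prod_geometric_le.
Qed.

(** With x = r^(k+1) <= r, each inverse factor is at most 1 / (1 - x) = 1 + x / (1 - x) <= 1 + x /
    (1 - r), so [prod_geometric_le] applies with c = r / (1 - r). *)
Lemma norm_qpochNV_le n :
  `|(qpoch (- q) q n)^-1| <= (expR (r / (1 - r) / (1 - r)))%:C.
Proof.
have r' : 0 < 1 - r by rewrite subr_gt0.
apply: (@le_trans _ _ (\prod_(0 <= k < n) (1 + r / (1 - r) * r ^+ k))%:C).
  rewrite normfV normr_prod -prodfV rmorph_prod; apply: ler_prod => k _.
  rewrite invr_ge0 normr_ge0 /= mulNr opprK -exprS.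
  have x0 : 0 <= r ^+ k.+1 by rewrite exprn_ge0.
  have xr : r ^+ k.+1 <= r by rewrite exprS ler_piMr // exprn_ile1 // ltW.
  have x1 : r ^+ k.+1 < 1 by apply: le_lt_trans xr r1.
  have lb : (1 - r ^+ k.+1)%:C <= `|1 + q ^+ k.+1|.
    by have := lerB_normD 1 (q ^+ k.+1); rewrite normr1 normX rmorphB rmorph1.
  have x1' : 0 < (1 - r ^+ k.+1)%:C.
    by rewrite -(rmorph0 (@real_complex R)) ltcR subr_gt0.
  apply: (@le_trans _ _ ((1 - r ^+ k.+1)^-1)%:C).
    by rewrite fmorphV lef_pV2 ?posrE // (lt_le_trans x1').
  rewrite lecR -[leLHS]mul1r ler_pdivrMr ?subr_gt0 //.
  rewrite mulrAC -exprS.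
  have -> : 1 + r ^+ k.+1 / (1 - r) = (1 - r + r ^+ k.+1) / (1 - r).
    by field; rewrite gt_eqF.
  by rewrite mulrAC ler_pdivlMr // mul1r; nra.
by rewrite lecR prod_geometric_le // divr_ge0 // ltW.
Qed.

(** The increments are -a q^n (a; q)_n, geometrically small since the partial products are
    bounded. *)
Lemma is_cvg_qpoch (a : R[i]) : cvgn (qpoch a q : nat -> R[i]^o).
Proof.
have h : cvgn (series (telescope (qpoch a q) : nat -> R[i]^o)).
  pose c := complex.Re `|a|.
  apply: (@is_cvgc_series _ _ (c * expR (c / (1 - r))) r) => // n.
  rewrite /telescope /= qpochS mulrBr mulr1 addrAC subrr add0r normrN.
  rewrite mulrC normrM [X in X * _]normrM normX normcE mulrAC !rmorphM /=.
  rewrite ler_wpM2r //.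
    by rewrite -(rmorph0 (@real_complex R)) lecR exprn_ge0.
  by rewrite ler_wpM2l // ?norm_qpoch_le // -normcE.
have /cvg_ex[l cl] := h.
pose u : nat -> R[i]^o := qpoch a q.
apply: (@cvgP _ _ (u 0%N + l)).
rewrite [qpoch a q](_ : _ = fun n => u 0%N + series (telescope u) n).
  exact: cvgD (cvg_cst _) cl.
by apply/funext => n; exact: eq_sum_telescope.
Qed.

Lemma is_cvg_sigma2 : cvgn (series (sigma2_term q) : nat -> R[i]^o).
Proof.
apply: (@is_cvgc_series _ _ (expR (r / (1 - r) / (1 - r))) r) => // n.
rewrite /sigma2_term !normrM normrX normrN1 expr1n mul1r normX mulrC rmorphM.
apply: ler_pM => //; [|exact: norm_qpochNV_le|].
  by rewrite -normX.
rewrite lecR ler_wiXn2l // ?ltW // -mulnn.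
by case: n => // n; rewrite leq_pmulr.
Qed.

Lemma qpoch_inf_split n :
  qpoch_inf (- q) q = qpoch (- q) q n * qpoch_inf (- q ^+ n.+1) q.
Proof.
have h : (fun m => qpoch (- q) q (m + n)) @ \oo -->
    (qpoch (- q) q n * qpoch_inf (- q ^+ n.+1) q : R[i]^o).
  under eq_fun do rewrite addnC qpochD mulNr -exprS.
  by apply: cvgMl_tmp; exact: is_cvg_qpoch.
apply: (@cvg_lim R[i]^o) => //; move: h.
by rewrite (cvg_shiftn n (qpoch (- q) q : nat -> R[i]^o)).
Qed.

Lemma cvg_series_b :
  series (fun n : nat => (b n)%:R * q ^+ n : R[i]^o) @ \oo -->
  (qpoch_inf (- q) q * sigma2 q : R[i]^o).
Proof.
(* Any s strictly between r and 1 makes both r / s and s ratios of convergent geometric series. *)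
have [s rs s1] : exists2 s, r < s & s < 1.
  by exists ((r + 1) / 2); have [] := midf_lt r1.
have s0 : 0 < s by apply: le_lt_trans rs.
pose T M : R[i]^o := qpoch (- q) q M * series (sigma2_term q) M.
have cT : T @ \oo --> (qpoch_inf (- q) q * sigma2 q : R[i]^o).
  by apply: cvgM; [exact: is_cvg_qpoch|exact: is_cvg_sigma2].
pose S : nat -> R[i]^o := series (fun n => (b n)%:R * q ^+ n : R[i]^o).
have cST : (fun M => S M - T M) @ \oo --> (0 : R[i]^o).
  apply: (@cvgc_to _ _ _ (geometric (expR (s / (1 - s)) / (1 - s)) (r / s))).
    move=> M; pose large n (B : {set 'I_M.+1}) :=
      parts_above n B && (M <= weight n B)%N.
    (* Weights below M contribute equally to both sides, by [alternating_weight_sum]; only the large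
       weights of [T M] survive. *)
    have -> : S M - T M =
        - \sum_(0 <= n < M) (-1) ^+ n * weight_sum q n (large n).
      rewrite /S /T qpochN_sigma2 // /series /= -alternating_weight_sum.
      rewrite -sumrB -sumrN; apply: eq_bigr => n _.
      rewrite -mulrBr -mulrN; congr (_ * _).
      rewrite /weight_sum [X in _ - X](bigID (fun B => weight n B < M)%N) /=.
      rewrite opprD addrA subrr add0r; congr (- _).
      by apply: eq_bigl => B; rewrite /large -leqNgt.
    rewrite opprK add0r (le_trans (ler_norm_sum _ _ _)) //.
    apply: (@le_trans _ _ (\sum_(0 <= n < M) weight_sum r n (large n))%:C);
      last first.
      by rewrite lecR weight_sum_tail ?r0.
    rewrite rmorph_sum; apply: ler_sum => n _.
    rewrite normrM normrX normrN1 expr1n mul1r /weight_sum rmorph_sum.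
    rewrite (le_trans (ler_norm_sum _ _ _)) //.
    by apply: ler_sum => B _; rewrite normX.
  apply: cvg_geometric; rewrite ger0_norm ?divr_ge0 ?(ltW s0) //.
  by rewrite ltr_pdivrMr // mul1r.
rewrite -[X in _ --> X](add0r (qpoch_inf (- q) q * sigma2 q : R[i]^o)).
rewrite [series _](_ : _ = fun M => (S M - T M) + T M).
  exact: cvgD cST cT.
by apply/funext => M; rewrite subrK.
Qed.

End Limits.

Theorem theorem1p2 (R : realType) (q : R[i]) (hq : `|q| < 1) :
  [/\ forall n : nat, cvgn (qpoch (- q ^+ n.+1) q),
      cvgn (series (sigma2_term q)),
      cvgn (series (fun n : nat => (b n)%:R * q ^+ n : R[i]^o)) &
      cvgn (series (fun n : nat =>
        (-1) ^+ n * q ^+ (n ^ 2) * qpoch_inf (- q ^+ n.+1) q : R[i]^o))] /\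
  limn (series (fun n : nat => (b n)%:R * q ^+ n : R[i]^o))
    = qpoch_inf (- q) q * sigma2 q /\
  qpoch_inf (- q) q * sigma2 q
    = limn (series (fun n : nat =>
        (-1) ^+ n * q ^+ (n ^ 2) * qpoch_inf (- q ^+ n.+1) q : R[i]^o)).
Proof.
have qE := normcE q; set r := complex.Re _ in qE.
have r01 : 0 <= r < 1.
  apply/andP; split; first exact: Re_norm_ge0.
  by rewrite -ltcR -qE rmorph1.
have cb := cvg_series_b qE r01.
have ct : series (fun n : nat => (-1) ^+ n * q ^+ (n ^ 2) *
      qpoch_inf (- q ^+ n.+1) q : R[i]^o) @ \oo -->
    (qpoch_inf (- q) q * sigma2 q : R[i]^o).
  (* Already for partial sums, since (-q^(n+1); q)_oo is (-q; q)_oo divided by the nonzero (-q;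
     q)_n. *)
  rewrite (_ : series _ =
      fun n => qpoch_inf (- q) q * series (sigma2_term q) n : R[i]^o).
    by apply: cvgMl_tmp; exact: is_cvg_sigma2 qE r01.
  apply/funext => M; rewrite /series /= mulr_sumr; apply: eq_bigr => n _.
  rewrite (qpoch_inf_split qE r01 n) /sigma2_term.
  by field; exact: qpochN_neq0.
split; first split.
- by move=> n; exact: is_cvg_qpoch qE r01 _.
- exact: is_cvg_sigma2 qE r01.
- exact: cvgP cb.
- exact: cvgP ct.
- by split; [|symmetry]; apply: (@cvg_lim R[i]^o).
Qed.
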